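(* Suppose that $(\mathcal{A},\mathcal{B},E,E')$ is a $C^*$-operator-valued infinitesimal probability space, and let $x,y\in\mathcal{A}$ be self-adjoint and infinitesimally Boolean independent over $\mathcal{B}$. Then for all $b\in H^+(\mathcal{B})$, $$g_{x+y}(b) = \big( F_x(b)+F_y(b)-b\big)^{-1} \Big( F_x(b)g_x(b)F_x(b) + F_y(b)g_y(b)F_y(b) \Big) \big(F_x(b)+F_y(b)-b\big)^{-1}.$$
   Context: A $C^*$-operator-valued infinitesimal probability space $(\mathcal{A},\mathcal{B},E,E')$ consists of a unital $C^*$-algebra $\mathcal{A}$, a unital $C^*$-subalgebra $\mathcal{B}\subseteq\mathcal{A}$, a linear completely positive map $E:\mathcal{A}\to\mathcal{B}$ with $E(b)=b$ and $E(bab')=bE(a)b'$ for all $a\in\mathcal{A}$, $b,b'\in\mathcal{B}$, and a linear completely bounded self-adjoint map $E':\mathcal{A}\to\mathcal{B}$ with $E'(1)=0$ and $E'(bab')=bE'(a)b'$. The operator upper half-plane is $H^+(\mathcal{B})=\{b\in\mathcal{B}: \frac{1}{2i}(b-b^* )>0\}$, where $>0$ means positive and invertible. For self-adjoint $x\in\mathcal{A}$ and $b\in H^+(\mathcal{B})$, $b-x$ is invertible, and one sets $G_x(b)=E[(b-x)^{-1}]$ (Cauchy transform), $F_x(b)=G_x(b)^{-1}$ ($F$-transform), and $g_x(b)=E'[(b-x)^{-1}]$ (infinitesimal Cauchy transform). Subalgebras $(\mathcal{A}_i)_{i\in I}$ of $\mathcal{A}$ containing $\mathcal{B}$ are infinitesimally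 Boolean independent over $\mathcal{B}$ if for all $n\in\mathbb{N}$ and $a_1,\dots,a_n\in\mathcal{A}$ with $a_j\in\mathcal{A}_{i_j}$, where $i_1\ne i_2\neq\cdots\ne i_n$ in $I$ (consecutive indices distinct), $$E(a_1\cdots a_n)=E(a_1)\cdots E(a_n),\qquad E'(a_1\cdots a_n)=\sum_{j=1}^n E(a_1)\cdots E(a_{j-1})E'(a_j)E(a_{j+1})\cdots E(a_n).$$ Elements $x,y$ are infinitesimally Boolean independent over $\mathcal{B}$ if the unital algebras they generate (as subalgebras containing $\mathcal{B}$) are. *)

(* Defs.v *)
From HB Require Import structures.
From mathcomp Require Import all_boot all_order all_algebra.
From mathcomp Require Import complex.
From mathcomp Require Import boolp classical_sets reals.
Import Order.TTheory GRing.Theory Num.Theory.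

Set Implicit Arguments.
Unset Strict Implicit.
Unset Printing Implicit Defensive.

Local Open Scope classical_set_scope.
Local Open Scope ring_scope.

(* The norm is a function to R rather than an instance of the library's normed
   modules: HB cannot join those with noncommutative unit rings, since
   numDomainType already inherits from both.
   Carriers are unitRingTypes, so 1 != 0, [GRing.unit] is exactly two-sided
   invertibility and [a^-1] is the genuine inverse of a unit. *)
HB.mixin Record isCStar (R : realType) A & GRing.UnitAlgebra R[i] A := {
  cnorm : A -> R;
  cnorm_eq0 : forall a : A, cnorm a = 0 -> a = 0;
  cnormD : forall a b : A, cnorm (a + b) <= cnorm a + cnorm b;
  cnormZ : forall (k : R[i]) (a : A), cnorm (k *: a) = complex.Re `|k| * cnorm a;
  cnormM : forall a b : A, cnorm (a * b) <= cnorm a * cnorm b;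
  cnorm_complete : forall u : nat -> A,
    (forall e : R, 0 < e -> exists N, forall m n : nat,
       (N <= m)%N -> (N <= n)%N -> cnorm (u m - u n) < e) ->
    exists l : A, forall e : R, 0 < e -> exists N, forall n : nat,
      (N <= n)%N -> cnorm (u n - l) < e;
  star : A -> A;
  starK : involutive star;
  starD : {morph star : a b / a + b};
  starZ : forall (k : R[i]) (a : A), star (k *: a) = k^* *: star a;
  starM : forall a b : A, star (a * b) = star b * star a;
  cstar_identity : forall a : A, cnorm (star a * a) = cnorm a ^+ 2
}.

#[short(type="cstarAlgType")]
HB.structure Definition CStarAlgebra (R : realType) :=
  {A of GRing.UnitAlgebra R[i] A & isCStar R A}.

Section CStar.
Context {R : realType}.
Implicit Types A B : cstarAlgType R.

Definition self_adjoint A (a : A) : Prop := star a = a.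

Definition spectrum A (a : A) : set R[i] :=
  [set l | a - l%:A \isn't a GRing.unit].

Definition positive A (a : A) : Prop :=
  self_adjoint a /\ spectrum a `<=` [set l | 0 <= l].

Definition mxstar A n (M : 'M[A]_n) : 'M[A]_n := (map_mx star M)^T.

(* [unitmx] needs commutative entries, hence the explicit inverse. *)
Definition mxinvertible A n (M : 'M[A]_n) : Prop :=
  exists N : 'M[A]_n, M *m N = 1%:M /\ N *m M = 1%:M.

Definition mxspectrum A n (M : 'M[A]_n) : set R[i] :=
  [set l | ~ mxinvertible (M - (l%:A)%:M)].

Definition mxpositive A n (M : 'M[A]_n) : Prop :=
  mxstar M = M /\ mxspectrum M `<=` [set l | 0 <= l].

Definition completely_positive A B (f : A -> B) : Prop :=
  forall n (M : 'M[A]_n), mxpositive M -> mxpositive (map_mx f M).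

(* The norm of the Hilbert A-module A^n: |v|^2 = |\sum_i v_i^* v_i|. *)
Definition colnorm A n (v : 'cV[A]_n) : R :=
  Num.sqrt (cnorm (\sum_(i < n) star (v i 0) * v i 0)).

(* The C*-norm of M_n(A): the operator norm of M acting on A^n. *)
Definition mxnorm A n (M : 'M[A]_n) : R :=
  sup [set colnorm (M *m v) | v in [set v : 'cV[A]_n | colnorm v <= 1]].

Definition completely_bounded A B (f : A -> B) : Prop :=
  exists K : R, forall n (M : 'M[A]_n), mxnorm (map_mx f M) <= K * mxnorm M.

(* A unital C*-subalgebra B of A is presented by its inclusion, a unital
   isometric *-homomorphism; completeness of B makes its image closed. *)
Record cstar_inclusion A B (inc : {lrmorphism B -> A}) : Prop := {
  inc_star : {morph inc : b / star b};
  inc_norm : forall b, cnorm (inc b) = cnorm b }.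

Record cstar_inf_prob_space A B (inc : {lrmorphism B -> A})
    (E E' : {linear A -> B}) : Prop := {
  space_inc : cstar_inclusion inc;
  expect_cp : completely_positive E;
  expect_id : forall b, E (inc b) = b;
  expect_bimod : forall a b b', E (inc b * a * inc b') = b * E a * b';
  inf_expect_cb : completely_bounded E';
  inf_expect_star : {morph E' : a / star a};
  inf_expect1 : E' 1 = 0;
  inf_expect_bimod : forall a b b', E' (inc b * a * inc b') = b * E' a * b' }.

Definition upper_half_plane B : set B :=
  [set b | positive ((2 * 'i)^-1 *: (b - star b)) /\
           (2 * 'i)^-1 *: (b - star b) \is a GRing.unit].

Section Transforms.
Variables (A B : cstarAlgType R) (inc : {lrmorphism B -> A}).

(* G_x for f = E, and g_x for f = E' *)
Definition cauchy_transform (f : A -> B) (x : A) (b : B) : B :=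
  f ((inc b - x)^-1).

Definition F_transform (E : A -> B) (x : A) (b : B) : B :=
  (cauchy_transform E x b)^-1.

(* Products are noncommutative; big operators keep the order of indices. *)
Definition inf_boolean_independent (E E' : A -> B) (I : Type)
    (S : I -> set A) : Prop :=
  forall n (i : 'I_n -> I) (a : 'I_n -> A),
    (forall j, S (i j) (a j)) ->
    (forall j k : 'I_n, k = j.+1 :> nat -> i j <> i k) ->
    E (\prod_(j < n) a j) = \prod_(j < n) E (a j) /\
    E' (\prod_(j < n) a j) =
      \sum_(j < n) (\prod_(k < n | (k < j)%N) E (a k)) * E' (a j)
                   * (\prod_(k < n | (j < k)%N) E (a k)).

(* The unital algebra generated by x over B. *)
Definition unital_generated_algebra (x : A) : set A :=
  [set a | forall S : {pred A}, GRing.subalg_closed S ->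
             (forall b, inc b \in S) -> x \in S -> a \in S].

(* The B-algebra generated by x without adjoining its unit: the span of the
   words b_0 x b_1 x ... x b_m with m >= 1 and b_j in B. *)
Definition generated_algebra (x : A) : set A :=
  [set a | forall S : {pred A}, submod_closed S -> GRing.mulr_2closed S ->
             (forall b s, s \in S -> inc b * s \in S /\ s * inc b \in S) ->
             x \in S -> a \in S].

(* Boolean independence is a condition on the non-unital B-algebras generated
   by x and y.  Imposing it on the unital ones is a strictly stronger
   requirement (next lemma) and a degenerate one: inserting a_2 = 1 in
   E(a_1 a_2 a_3) = E(a_1) E(a_2) E(a_3) makes E multiplicative on the algebra
   generated by x, y and B, and E' a bounded derivation along E vanishing on B,
   hence zero, on its closure, so that all infinitesimal transforms vanish. *)
Definition elements_inf_boolean_independent (E E' : A -> B) (x y : A) : Prop :=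
  inf_boolean_independent E E'
    (fun k : bool => generated_algebra (if k then x else y)).

Lemma unital_inf_boolean_independent (E E' : A -> B) (x y : A) :
  inf_boolean_independent E E'
    (fun k : bool => unital_generated_algebra (if k then x else y)) ->
  elements_inf_boolean_independent E E' x y.
Proof.
move=> h n i a ha; apply: h => j S /[dup] /GRing.subalg_closedZ Ssub [_ _ SM] SB Sx.
apply: ha => // b s sS; split; exact: SM.
Qed.

End Transforms.
End CStar.

(* Main.v *)
(** Write X, Y, T for the resolvents of x, y, x + y at b. Since
    (1 + y T) = (b - x) T, one has x T = x X + (x X) (y T), and symmetrically for y.
    Here x X is a norm limit of elements of the non-unital algebra generated by x,
    and y T one of combinations of alternating words starting in that generated by y,
    so Boolean independence and continuity give
    E (x T) = E (x X) + E (x X) E (y T), together with its Leibniz version for E'.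
    As b X = 1 + x X and b T = 1 + x T + y T, these are linear equations which yield
    1 + E (y T) = F_x G, 1 + E (x T) = F_y G with G = G_{x+y}, hence
    (F_x + F_y - b) G = 1, and, for E', the claimed formula. No convergence of a
    series in b is involved, so the argument works at every b in the half-plane.

    The C*-algebraic input is elementary: for h self-adjoint and t > 0 the Cayley
    transform (h - it) / (h + it) is unitary, which bounds (h + it)^-1 by 1/t; one of
    |h|, -|h| lies in the spectrum of h; and a
    positive unit c has an invertible square root q, so that an element k + ic of the
    half-plane is q (h + i) q with h self-adjoint. *)
Require Import Defs.
From HB Require Import structures.
From mathcomp Require Import all_boot all_order all_algebra.
From mathcomp Require Import complex ring lra.
From mathcomp Require Import boolp classical_sets reals.
Import Order.TTheory GRing.Theory Num.Theory.
Local Open Scope ring_scope.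

(** * The norm and the involution *)

(** Since r^n is at most each r^i with i < n, n(1 - r) r^n is at most (1 - r)(1 + ... + r^(n-1)) = 1
    - r^n, so r^n decays at least like 1 / (n(1 - r)). *)
Lemma geometric_lt (R : realType) (r e : R) :
  0 <= r -> r < 1 -> 0 < e -> exists N, forall n, (N <= n)%N -> r ^+ n < e.
Proof.
move=> r0 r1 e0.
have d0 : 0 < 1 - r by rewrite subr_gt0.
have key n : n%:R * (1 - r) * r ^+ n <= 1.
  have -> : n%:R * (1 - r) * r ^+ n = (1 - r) * \sum_(i < n) r ^+ n.
    by rewrite sumr_const card_ord -mulr_natl; ring.
  apply: (@le_trans _ _ ((1 - r) * \sum_(i < n) r ^+ i)).
    apply: ler_wpM2l; first exact: ltW.
    by apply: ler_sum => i _; apply: ler_wiXn2l => //; [exact: ltW|exact: ltnW].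
  by rewrite -opprB mulNr -subrX1 opprB gerBl exprn_ge0.
have [N hN] : exists N, (e * (1 - r))^-1 < N%:R :> R.
  exists (Num.bound (e * (1 - r))^-1); apply: archi_boundP.
  by rewrite invr_ge0 mulr_ge0 // ltW.
exists N => n Nn.
have ed0 : 0 < e * (1 - r) by rewrite mulr_gt0.
have n1 : 1 < n%:R * (e * (1 - r)).
  rewrite -ltr_pdivrMr // mul1r (lt_le_trans hN) // ler_nat //.
have n0 : 0 < n%:R * (1 - r).
  rewrite mulr_gt0 // ltr0n; case: n {Nn} n1 => //; rewrite mul0r; lra.
rewrite -(ltr_pM2l n0) (le_lt_trans (key n)) //.
by rewrite -mulrA (mulrC _ e).
Qed.

Section CStarAlgebra.
Context {R : realType} {A : cstarAlgType R}.
Implicit Types (a b u v w h : A) (t : R).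

Lemma cnormZr t a : cnorm (t%:C%C *: a) = `|t| * cnorm a.
Proof. by rewrite cnormZ normc_def /= expr0n /= addr0 sqrtr_sqr. Qed.

Lemma cnormZi a : cnorm ('i *: a) = cnorm a.
Proof. by rewrite cnormZ -complexiE normc_def /= expr0n /= add0r expr1n sqrtr1 mul1r. Qed.

Lemma cnormN a : cnorm (- a) = cnorm a.
Proof. by rewrite -scaleN1r -(rmorphN1 (real_complex R)) cnormZr normrN1 mul1r. Qed.

Lemma cnorm0 : cnorm (0 : A) = 0.
Proof. by rewrite -(scale0r 0) -(rmorph0 (real_complex R)) cnormZr normr0 mul0r. Qed.

Lemma cnormB a b : cnorm (a - b) <= cnorm a + cnorm b.
Proof. by rewrite -(cnormN b) cnormD. Qed.

Lemma cnorm_ge0 a : 0 <= cnorm a.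
Proof. by have := cnormB a a; rewrite subrr cnorm0 -mulr2n pmulrn_lge0. Qed.

Lemma starZr t a : star (t%:C%C *: a) = t%:C%C *: star a.
Proof. by rewrite starZ; congr (_ *: _); exact: conjc_real. Qed.

Lemma starZi a : star ('i *: a) = - ('i *: star a).
Proof. by rewrite starZ conjCi scaleNr. Qed.

Lemma star0 : star 0 = 0 :> A.
Proof. by apply: (@addrI _ (star 0)); rewrite -starD !addr0. Qed.

Lemma starN : {morph @star R A : a / - a}.
Proof. by move=> a; apply: (@addrI _ (star a)); rewrite -starD !subrr star0. Qed.

Lemma starB : {morph @star R A : a b / a - b}.
Proof. by move=> a b; rewrite starD starN. Qed.

Lemma star1 : star 1 = 1 :> A.
Proof. by rewrite -[LHS]mul1r -{1}(starK 1) -starM mul1r starK. Qed.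

Lemma cnorm1 : cnorm (1 : A) = 1.
Proof.
have := cstar_identity (1 : A); rewrite star1 mulr1 => h.
have n0 : cnorm (1 : A) != 0.
  by apply/eqP => /cnorm_eq0 /eqP; rewrite oner_eq0.
by apply: (mulfI n0); rewrite mulr1 -expr2.
Qed.

Lemma cnormA t : cnorm (t%:C%C%:A : A) = `|t|.
Proof. by rewrite cnormZr cnorm1 mulr1. Qed.

Lemma cnorm_star a : cnorm (star a) = cnorm a.
Proof.
suff le b : cnorm b <= cnorm (star b).
  by apply/eqP; rewrite eq_le le andbT -{2}(starK a) le.
have := cnormM (star b) b; rewrite cstar_identity expr2.
have := cnorm_ge0 b; rewrite le_eqVlt => /orP[/eqP <- _|b0]; first exact: cnorm_ge0.
by rewrite ler_pM2r.
Qed.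

Lemma cnorm_sqr a : self_adjoint a -> cnorm (a ^+ 2) = cnorm a ^+ 2.
Proof. by move=> sa; rewrite -cstar_identity sa. Qed.

Lemma cnormX_le a n : cnorm (a ^+ n) <= cnorm a ^+ n.
Proof.
elim: n => [|n IH]; first by rewrite !expr0 cnorm1.
by rewrite !exprS (le_trans (cnormM _ _)) // ler_wpM2l // cnorm_ge0.
Qed.

Lemma star_unit a : (star a \is a GRing.unit) = (a \is a GRing.unit).
Proof.
suff imp b : b \is a GRing.unit -> star b \is a GRing.unit.
  by apply/idP/idP => /imp; rewrite ?starK.
by move=> ub; apply/unitrP; exists (star b^-1); rewrite -!starM divrr // mulVr // star1.
Qed.

Lemma starV a : star a^-1 = (star a)^-1.
Proof.
have [ua|nua] := boolP (a \is a GRing.unit); last by rewrite !invr_out // star_unit.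
apply: (mulrI (x := star a)); rewrite ?star_unit //.
by rewrite -starM mulVr // divrr ?star_unit // star1.
Qed.

Lemma cauchy_geometric (u : nat -> A) (K r : R) : 0 <= r -> r < 1 ->
    (forall n, cnorm (u n.+1 - u n) <= K * r ^+ n) ->
  exists l, forall e, 0 < e ->
    exists N, forall n, (N <= n)%N -> cnorm (u n - l) < e.
Proof.
move=> r0 r1 hu; apply: cnorm_complete => e e0.
have d0 : 0 < 1 - r by rewrite subr_gt0.
have K0 : 0 <= K by have := hu 0%N; rewrite expr0 mulr1; apply/le_trans/cnorm_ge0.
(* Telescoping gives the geometric tail; both sides carry the factor 1 - r so that no division
   occurs. *)
have tail n k : (1 - r) * cnorm (u (n + k)%N - u n) <= K * (r ^+ n - r ^+ (n + k)).
  elim: k => [|k IH]; first by rewrite addn0 !subrr cnorm0 !mulr0.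
  rewrite addnS -(subrK (u (n + k)%N) (u (n + k).+1)) -addrA.
  apply: (le_trans (ler_wpM2l (ltW d0) (cnormD _ _))).
  rewrite mulrDr (le_trans (lerD (ler_wpM2l (ltW d0) (hu _)) IH)) //.
  rewrite exprS; lra.
(* The denominator is K + 1 because K may be 0. *)
have e'0 : 0 < e * (1 - r) / (K + 1).
  by rewrite !mulr_gt0 // invr_gt0; lra.
have [N hN] := geometric_lt R r _ r0 r1 e'0.
have main m n : (N <= n <= m)%N -> cnorm (u m - u n) < e.
  move=> /andP[Nn /subnKC <-]; rewrite -(ltr_pM2l d0).
  apply: (le_lt_trans (tail _ _)).
  have /hN := Nn; rewrite ltr_pdivlMr; last lra.
  have := exprn_ge0 n r0; have := exprn_ge0 (n + (m - n)) r0.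
  nra.
exists N => m n Nm Nn; have [mn|/ltnW nm] := leqP m n; last by apply: main; rewrite Nn.
by rewrite -cnormN opprB; apply: main; rewrite Nm.
Qed.

Lemma cnorm_lt_eq0 a : (forall e, 0 < e -> cnorm a < e) -> a = 0.
Proof.
move=> ha; apply: cnorm_eq0; apply/eqP; rewrite eq_le cnorm_ge0 andbT leNgt.
by apply/negP => /ha; rewrite ltxx.
Qed.

End CStarAlgebra.

(** * Neumann series and resolvents of self-adjoint elements *)

Definition norm_closure {R : realType} {A : cstarAlgType R} (P : A -> Prop) (a : A) : Prop :=
  forall e, 0 < e -> exists s, P s /\ cnorm (a - s) < e.

Record subalgebra {R : realType} {A : cstarAlgType R} (P : A -> Prop) : Prop := {
  subalgebra1 : P 1;
  subalgebraD : forall a b, P a -> P b -> P (a + b);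
  subalgebraZ : forall k a, P a -> P (k *: a);
  subalgebraM : forall a b, P a -> P b -> P (a * b) }.

(** Carrying such a predicate [T] through the invertibility lemmas also locates the inverse: with
    [full_subalgebra] they give bare invertibility, with a multiplier algebra they place a resolvent
    in its closure. These multiplier algebras are one-sided, so [star] does not occur. *)
Record closed_subalgebra {R : realType} {A : cstarAlgType R} (P : A -> Prop) : Prop := {
  closed_subalgebra_sub : subalgebra P;
  closed_subalgebra_norm_closure : forall a, norm_closure P a -> P a }.

Section Closure.
Context {R : realType} {A : cstarAlgType R}.
Implicit Types (a b u v w h : A) (t : R) (P T : A -> Prop).

Lemma subset_norm_closure P a : P a -> norm_closure P a.
Proof. by move=> Pa e e0; exists a; rewrite subrr cnorm0. Qed.

Lemma norm_closure_idem P a : norm_closure (norm_closure P) a -> norm_closure P a.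
Proof.
move=> Pa e e0; have e20 : 0 < e / 2 by lra.
have [s [Ps hs]] := Pa _ e20; have [s' [Ps' hs']] := Ps _ e20.
exists s'; split=> //; rewrite -(subrK s a) -addrA (le_lt_trans (cnormD _ _)) //.
by rewrite (splitr e) ltrD.
Qed.

End Closure.

Section Resolvents.
Context {R : realType} {A : cstarAlgType R}.
Implicit Types (a b u v w h : A) (t : R) (P T : A -> Prop).

Lemma norm_closure_lipschitz {B : cstarAlgType R} (f : A -> B) (K : R) P (Q : B -> Prop) a :
    (forall b, cnorm (f a - f b) <= K * cnorm (a - b)) ->
    (forall b, P b -> norm_closure Q (f b)) ->
  norm_closure P a -> norm_closure Q (f a).
Proof.
move=> fK fP Pa; apply: norm_closure_idem => e e0.
have K0 : 0 < `|K| + 1 by rewrite ltr_wpDl.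
have [|s [Ps hs]] := Pa (e / (`|K| + 1)); first by rewrite divr_gt0.
exists (f s); split; first exact: fP.
rewrite ltr_pdivlMr // in hs; apply: le_lt_trans hs.
rewrite (le_trans (fK s)) // mulrC ler_wpM2l ?cnorm_ge0 //.
by rewrite (le_trans (ler_norm _)) // lerDl.
Qed.

Lemma norm_closure_mull P Q u a : (forall b, P b -> norm_closure Q (u * b)) ->
  norm_closure P a -> norm_closure Q (u * a).
Proof.
by apply: (norm_closure_lipschitz (fun a => u * a) (cnorm u)) => b; rewrite -mulrBr cnormM.
Qed.

Lemma norm_closure_mulr P Q u a : (forall b, P b -> norm_closure Q (b * u)) ->
  norm_closure P a -> norm_closure Q (a * u).
Proof.
by apply: (norm_closure_lipschitz (fun a => a * u) (cnorm u)) => b; rewrite -mulrBl mulrC cnormM.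
Qed.

Lemma norm_closure_subalgebra P : subalgebra P -> closed_subalgebra (norm_closure P).
Proof.
case=> P1 PD PZ PM; split; last exact: norm_closure_idem.
split.
- exact: subset_norm_closure.
- move=> a b Pa Pb e e0; have e20 : 0 < e / 2 by lra.
  have [s [Ps hs]] := Pa _ e20; have [s' [Ps' hs']] := Pb _ e20.
  exists (s + s'); split; first exact: PD.
  by rewrite opprD addrACA (le_lt_trans (cnormD _ _)) // (splitr e) ltrD.
- move=> k a; rewrite -mulr_algl; apply: norm_closure_mull => b Pb.
  by apply: subset_norm_closure; rewrite mulr_algl; apply: PZ.
- move=> a b Pa Pb; move: Pa; apply: norm_closure_mulr => s Ps.
  by move: Pb; apply: norm_closure_mull => s' Ps'; apply/subset_norm_closure/PM.
Qed.

Lemma full_subalgebra : closed_subalgebra (fun _ : A => True).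
Proof. by []. Qed.

Lemma neumann T u : closed_subalgebra T -> T u -> cnorm u < 1 ->
  1 - u \is a GRing.unit /\ T (1 - u)^-1.
Proof.
move=> [[T1 TD TZ TM] Tcl] Tu u1; have u0 := cnorm_ge0 u.
pose s n := \sum_(i < n) u ^+ i.
have [n|l hl] := cauchy_geometric s 1 (cnorm u) u0 u1.
  by rewrite /s big_ord_recr /= addrAC subrr add0r mul1r cnormX_le.
have TX n : T (u ^+ n) by elim: n => [|n IH]; rewrite ?expr0 // exprS; apply: TM.
have Ts n : T (s n).
  rewrite /s; elim: n => [|n IH]; last by rewrite big_ord_recr; apply: TD.
  by rewrite big_ord0 -(scale0r 1); apply: TZ.
have Tl : T l.
  apply: Tcl => e /hl[N hN]; exists (s N); split=> //.
  by rewrite -cnormN opprB hN.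
have us n : u * s n = s n * u.
  by rewrite /s mulr_sumr mulr_suml; apply: eq_bigr => i _; rewrite -exprS -exprSr.
have su n : (1 - u) * s n = 1 - u ^+ n.
  by rewrite -[1 - u]opprB -[RHS]opprB mulNr subrX1.
(* Passes to the limit in (1 - u) s_n = 1 - u^n, for a general [f] so as to serve both left and
   right multiplication by 1 - u. *)
have tend f : (forall n, f (s n) = 1 - u ^+ n) ->
    (forall n, cnorm (f l - f (s n)) <= cnorm (1 - u) * cnorm (s n - l)) -> f l = 1.
  move=> fs fK; apply/eqP; rewrite -subr_eq0; apply/eqP; apply: cnorm_lt_eq0 => e e0.
  have K0 : 0 < 2 * (cnorm (1 - u) + 1) by rewrite mulr_gt0 ?ltr_wpDl ?cnorm_ge0.
  have [|N hN] := hl (e / (2 * (cnorm (1 - u) + 1))); first by rewrite divr_gt0.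
  have [|M hM] := geometric_lt R (cnorm u) (e / 2) u0 u1; first lra.
  have /hN hn := leq_maxl N M; have /hM hm := leq_maxr N M.
  set n := maxn N M in hn hm.
  have -> : f l - 1 = f l - f (s n) - u ^+ n by rewrite fs opprD opprK addrA addrK.
  rewrite (le_lt_trans (cnormB _ _)) // (splitr e) ler_ltD //; last first.
    exact: (le_lt_trans (cnormX_le _ _)).
  apply: (le_trans (fK n)); rewrite ltr_pdivlMr // in hn.
  by have := cnorm_ge0 (s n - l); nra.
have l1 : (1 - u) * l = 1.
  apply: (tend (fun a => (1 - u) * a)) => // n.
  by rewrite -mulrBr -[cnorm (s n - l)]cnormN opprB cnormM.
have l2 : l * (1 - u) = 1.
  apply: (tend (fun a => a * (1 - u))) => n.
    by rewrite mulrBr mulr1 -us -{1}(mul1r (s n)) -mulrBl.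
  by rewrite -mulrBl -[cnorm (s n - l)]cnormN opprB mulrC cnormM.
have un : 1 - u \is a GRing.unit by apply/unitrP; exists l.
by split=> //; have -> : (1 - u)^-1 = l by apply: (mulrI un); rewrite divrr.
Qed.

(** Neumann series for the second factor of u + w = u (1 + u^-1 w). *)
Lemma unit_perturb T u w : closed_subalgebra T ->
    u \is a GRing.unit -> T u^-1 -> T w -> cnorm u^-1 * cnorm w < 1 ->
  u + w \is a GRing.unit /\ T (u + w)^-1.
Proof.
move=> hT uu Tu Tw h; have [[_ _ TZ TM] _] := hT.
have -> : u + w = u * (1 - (- (u^-1 * w))) by rewrite opprK mulrDr mulr1 mulVKr.
have [||vu Tv] := neumann T (- (u^-1 * w)) hT.
- by rewrite -scaleN1r; apply/TZ/TM.
- by rewrite cnormN (le_lt_trans (cnormM _ _)).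
by rewrite unitrMr // invrM //; split=> //; apply: TM.
Qed.

Definition imag t : A := ('i * t%:C%C)%:A.

Lemma cnorm_imag t : cnorm (imag t) = `|t|.
Proof. by rewrite /imag -scalerA cnormZi cnormA. Qed.

Lemma star_imag t : star (imag t) = - imag t.
Proof. by rewrite /imag -!scalerA starZi starZr star1. Qed.

Lemma imagD t1 t2 : imag (t1 + t2) = imag t1 + imag t2.
Proof. by rewrite /imag rmorphD mulrDr scalerDl. Qed.

Lemma imagM t1 t2 : imag t1 * imag t2 = - (t1 * t2)%:C%C%:A.
Proof.
rewrite /imag -scalerAl mul1r scalerA mulrACA -expr2 sqrCi mulN1r scaleNr.
by rewrite rmorphM.
Qed.

Lemma comm_imag t a : GRing.comm a (imag t).
Proof. by rewrite /GRing.comm /imag mulr_algr mulr_algl. Qed.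

Lemma unit_alg (k : R[i]) : k != 0 -> k%:A \is a (@GRing.unit A).
Proof. by move=> k0; rewrite scaler_unit ?unitr1 // unitfE. Qed.

Lemma unit_imag t : t != 0 -> imag t \is a GRing.unit.
Proof.
by move=> t0; rewrite unit_alg // mulf_neq0 ?neq0Ci // (inj_eq (@complexI R) t 0).
Qed.

Lemma cnorm_unitary w : star w * w = 1 -> cnorm w = 1.
Proof.
move=> hw; have := cstar_identity w; rewrite hw cnorm1 => /esym/eqP.
by rewrite sqrf_eq1 => /orP[/eqP //|/eqP h]; have := cnorm_ge0 w; rewrite h ler0N1.
Qed.

Lemma cayley_unitary h t : self_adjoint h -> h + imag t \is a GRing.unit ->
  star ((h - imag t) * (h + imag t)^-1) * ((h - imag t) * (h + imag t)^-1) = 1.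
Proof.
move=> sh hu; have hu' : h - imag t \is a GRing.unit.
  by rewrite -star_unit starB sh star_imag opprK.
have c : (h + imag t) * (h - imag t) = (h - imag t) * (h + imag t).
  rewrite !mulrDl !mulrDr !mulrN !mulNr -(comm_imag t h) -!addrA; congr (_ + _).
  by rewrite !addrA; congr (_ - _); rewrite addrC.
rewrite starM starV starB starD sh star_imag opprK mulrA -(mulrA _^-1) c.
by rewrite mulKr // divrr.
Qed.

(** With w the Cayley transform, 1 - w = 2it (h + it)^-1, and the left side has norm at most 2.
    Invertibility is a hypothesis because the bound at one parameter serves to prove invertibility
    at others. *)
Lemma resolvent_bound h t : self_adjoint h -> 0 < t ->
  h + imag t \is a GRing.unit -> cnorm (h + imag t)^-1 <= t^-1.
Proof.
move=> sh t0 hu; have /cnorm_unitary := cayley_unitary h t sh hu.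
set w := (_ * _) => w1.
have e : (2 * t)%:C%C *: ('i *: (h + imag t)^-1) = 1 - w.
  rewrite /w -[X in X - _](divrr hu) -mulrBl opprD opprK addrACA subrr add0r.
  by rewrite -imagD /imag mulr_algl scalerA mulrC -mulr2n mulr_natl.
have : cnorm (1 - w) <= 2 by rewrite (le_trans (cnormB _ _)) // cnorm1 w1.
rewrite -e cnormZr cnormZi gtr0_norm; last lra.
by move=> hb; rewrite -(ler_pM2l t0) mulfV ?gt_eqF //; lra.
Qed.

Lemma resolvent_mem T h t : closed_subalgebra T -> self_adjoint h -> T h ->
  0 < t -> h + imag t \is a GRing.unit /\ T (h + imag t)^-1.
Proof.
move=> hT sh Th t0; have [[T1 TD TZ TM] _] := hT.
(* This s exceeds |h|, so [imag s + h] is inverted by a Neumann series. As |t - s| = |h| + 1 < s,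
   the bound 1/s on that inverse lets a second perturbation reach t in one step. *)
pose s := cnorm h + t + 1; have n0 := cnorm_ge0 h.
have s0 : 0 < s by rewrite /s; lra.
have Ti x : T (imag x) by apply: TZ.
have iV : (imag s)^-1 = imag (- s^-1).
  have us : imag s \is a GRing.unit by rewrite unit_imag ?gt_eqF.
  apply: (mulrI us).
  rewrite divrr // imagM mulrN mulfV ?gt_eqF //.
  by rewrite rmorphN scaleNr opprK rmorph1 scale1r.
have [||||u1 T1s] := unit_perturb T (imag s) h hT.
- by rewrite unit_imag ?gt_eqF.
- by rewrite iV.
- by [].
- rewrite iV cnorm_imag normrN gtr0_norm ?invr_gt0 // mulrC ltr_pdivrMr // mul1r /s; lra.
have -> : h + imag t = (imag s + h) + imag (t - s).
  by rewrite (addrC (imag s)) -addrA -imagD addrCA subrr addr0.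
apply: unit_perturb => //; rewrite addrC in u1 *.
have := resolvent_bound h s sh s0 u1; rewrite cnorm_imag => hb.
apply: (@le_lt_trans _ _ (s^-1 * `|t - s|)); first exact: ler_wpM2r.
by rewrite mulrC ltr_pdivrMr // mul1r ltr_norml /s; apply/andP; split; lra.
Qed.

Lemma unit_imagD h t : self_adjoint h -> t != 0 -> h + imag t \is a GRing.unit.
Proof.
move=> sh; rewrite neq_lt => /orP[t0|t0]; last first.
  by have [] := resolvent_mem _ h t full_subalgebra sh I t0.
have [|+ _] := resolvent_mem _ h (- t) full_subalgebra sh I; first lra.
rewrite -star_unit starD sh star_imag -scaleNr -mulrN -rmorphN opprK //.
Qed.

End Resolvents.

(** * Spectra and square roots *)

Section Spectrum.
Context {R : realType} {A : cstarAlgType R}.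
Implicit Types (a b c e h k q s : A) (t r : R).

Lemma self_adjointD a b : self_adjoint a -> self_adjoint b -> self_adjoint (a + b).
Proof. by rewrite /self_adjoint starD => -> ->. Qed.

Lemma self_adjointB a b : self_adjoint a -> self_adjoint b -> self_adjoint (a - b).
Proof. by rewrite /self_adjoint starB => -> ->. Qed.

Lemma self_adjointZ t a : self_adjoint a -> self_adjoint (t%:C%C *: a).
Proof. by rewrite /self_adjoint starZr => ->. Qed.

Lemma self_adjointA t : self_adjoint (t%:C%C%:A : A).
Proof. by apply: self_adjointZ; apply: star1. Qed.

Lemma self_adjoint_sqr a : self_adjoint a -> self_adjoint (a * a).
Proof. by rewrite /self_adjoint starM => ->. Qed.

Lemma self_adjointV a : self_adjoint a -> self_adjoint a^-1.
Proof. by rewrite /self_adjoint starV => ->. Qed.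

Lemma add1_sqr_factor s : 1 + s * s = (s - imag 1) * (s + imag 1).
Proof.
rewrite mulrDr !mulrBl (comm_imag 1 s) addrA subrK imagM.
by rewrite mulr1 rmorph1 scale1r opprK addrC.
Qed.

Lemma unit_add1_sqr s : self_adjoint s -> 1 + s * s \is a GRing.unit.
Proof.
move=> ss; rewrite add1_sqr_factor unitrMr ?unit_imagD ?oner_eq0 //.
rewrite -star_unit starB star_imag opprK ss; exact: unit_imagD ss (oner_neq0 _).
Qed.

Lemma comm_inv_add1_sqr s : GRing.comm s (1 + s * s)^-1.
Proof. by apply/commrV/commrD; [exact: commr1 | exact/commrM]. Qed.

(* [w - star w], for the Cayley transform [w] of [s], is [-4i s / (1 + s^2)]. *)
Lemma cnorm_div_add1_sqr s : self_adjoint s -> cnorm ((1 + s * s)^-1 * s) <= 1 / 2.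
Proof.
move=> ss; have uD := unit_add1_sqr s ss; set D := 1 + s * s in uD *.
have ui := unit_imagD s 1 ss (oner_neq0 _).
have ui' : s - imag 1 \is a GRing.unit by rewrite -star_unit starB star_imag opprK ss.
have wW := cayley_unitary s 1 ss ui.
set w := (s - imag 1) / (s + imag 1) in wW.
have w1 := cnorm_unitary w wW.
have e : D^-1 * (imag 4 * s) = star w - w.
  apply: (mulrI uD); rewrite mulVKr // mulrBr.
  have c : GRing.comm (s - imag 1) D.
    apply/commrD; first exact: commr1.
    by apply/commr_sym/commrB; [exact/commr_sym/commrM | exact/comm_imag].
  have -> : D * w = (s - imag 1) * (s - imag 1).
    rewrite /w mulrA -c {1}/D add1_sqr_factor !mulrA mulrK //.
  have -> : D * star w = (s + imag 1) * (s + imag 1).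
    rewrite /w starM starV starB starD star_imag ss opprK.
    have c0 : GRing.comm (s - imag 1) (s + imag 1).
      by apply/commrD; [apply/commr_sym/commrB => // |]; apply: comm_imag.
    by rewrite {1}/D add1_sqr_factor c0 -mulrA mulVKr.
  have -> : imag 4 = imag 1 + imag 1 + imag 1 + imag 1 :> A.
    by rewrite -!imagD; congr imag; ring.
  rewrite !mulrDr !mulrDl !mulrN !mulNr opprK -!(comm_imag 1 s).
  rewrite !opprD !opprK -!addrA; move: (s * s) (s * imag 1) (imag 1 * imag 1) => x y z.
  rewrite [RHS]addrC -!addrA; do 2 congr (_ + _).
  by rewrite [- x + _]addrC -!addrA subrr addr0 [RHS]addrC -!addrA addNr addr0.
have : cnorm (star w - w) <= 2 by rewrite (le_trans (cnormB _ _)) // cnorm_star w1.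
rewrite -e mulrA (comm_imag 4 D^-1) -mulrA /imag mulr_algl -scalerA cnormZi cnormZr.
by rewrite gtr0_norm; lra.
Qed.

(** With D = 1 + s^2 and z = D^-1 s, the element is D z^2, where |D| <= 2 and |z| <= 1/2. *)
Lemma cnorm_sqr_div_add1_sqr s : self_adjoint s -> cnorm s <= 1 ->
  cnorm ((1 + s * s)^-1 * (s * s)) <= 1 / 2.
Proof.
move=> ss s1; have uD := unit_add1_sqr s ss; have zb := cnorm_div_add1_sqr s ss.
have cs := comm_inv_add1_sqr s.
set D := 1 + s * s in uD zb cs *; set z := D^-1 * s in zb.
have -> : D^-1 * (s * s) = D * (z * z).
  by rewrite {1}/z -!mulrA mulVKr // /z !mulrA cs.
have s0 := cnorm_ge0 s; have z0 := cnorm_ge0 z.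
have D2 : cnorm D <= 2.
  rewrite (le_trans (cnormD _ _)) // cnorm1.
  have := cnormM s s; nra.
have := cnormM D (z * z); have := cnormM z z; have := cnorm_ge0 (z * z).
have := cnorm_ge0 D; nra.
Qed.

(* With [k_m = h^(2^(m+1))], the element [e_m = k_m / (1 - k_m)] satisfies
   [e_(m+1) = e_m * k_m / (1 + k_m)], hence tends to 0, whereas [k_m] has norm 1. *)
Lemma one_sub_sqr_nonunit h : self_adjoint h -> cnorm h = 1 ->
  1 - h * h \isn't a GRing.unit.
Proof.
move=> sh h1; apply/negP => u.
pose M := cnorm (h * h / (1 - h * h)).
have key m : exists s e, [/\ self_adjoint s, cnorm s = 1,
    e * (1 - s * s) = s * s & cnorm e <= M * (1 / 2) ^+ m].
  elim: m => [|m [s [e [ss s1 es em]]]].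
    by exists h, (h * h / (1 - h * h)); rewrite expr0 mulr1 divrK.
  have uD := unit_add1_sqr s ss.
  have cs := comm_inv_add1_sqr s.
  have yb : cnorm ((1 + s * s)^-1 * (s * s)) <= 1 / 2.
    by apply: cnorm_sqr_div_add1_sqr; rewrite ?s1.
  exists (s * s), (e * ((1 + s * s)^-1 * (s * s))); split.
  - exact: self_adjoint_sqr.
  - by have := cnorm_sqr s ss; rewrite s1 expr1n expr2.
  - have ck : GRing.comm (s * s) (1 + s * s)^-1 by apply/commr_sym/commrM; apply/commr_sym.
    set k := s * s in uD ck es *.
    have -> : 1 - k * k = (1 - k) * (1 + k).
      by rewrite mulrDr mulr1 mulrBl mul1r addrA subrK.
    have c1 : GRing.comm ((1 + k)^-1 * k) (1 - k).
      apply/commrB; first exact: commr1.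
      by apply/commr_sym/commrM.
    by rewrite mulrA -(mulrA e) c1 (mulrA e) es -ck !mulrA divrK.
  - rewrite exprS (le_trans (cnormM _ _)) //.
    have := cnorm_ge0 e; have := cnorm_ge0 ((1 + s * s)^-1 * (s * s)).
    nra.
have M0 : 0 <= M := cnorm_ge0 _.
(* This threshold makes |e| < 1/4, against 1 = |s^2| <= |e| |1 - s^2| <= 2 |e|. It has M + 1 because
   M may be 0. *)
have [|||N hN] := geometric_lt R (1 / 2) (1 / (4 * (M + 1))); [lra|lra| |].
  by rewrite divr_gt0 //; lra.
have [s [e [ss s1 es em]]] := key N.
have := hN N (leqnn _); rewrite ltr_pdivlMr; last lra.
have : 1 <= cnorm e * 2.
  have <- : cnorm (s * s) = 1 by have := cnorm_sqr s ss; rewrite s1 expr1n expr2.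
  rewrite -{1}es (le_trans (cnormM _ _)) // ler_wpM2l ?cnorm_ge0 //.
  rewrite (le_trans (cnormB _ _)) // cnorm1.
  have := cnorm_sqr s ss; rewrite s1 expr1n expr2 => ->; lra.
have p0 : 0 <= (1 / 2 : R) ^+ N by rewrite exprn_ge0 //; lra.
nra.
Qed.

(** After scaling h to s of norm 1, both factors of 1 - s^2 = (1 - s)(1 + s) would be invertible.
    This plays the part of the spectral radius formula: a norm bound follows once too large a norm
    would keep |h| and -|h| out of the spectrum. *)
Lemma cnorm_spectrum h : self_adjoint h ->
  ~ ((cnorm h)%:C%C%:A - h \is a GRing.unit /\ (cnorm h)%:C%C%:A + h \is a GRing.unit).
Proof.
move=> sh [u1 u2]; have [n0|n0] := eqVneq (cnorm h) 0.
  by move: u1; rewrite n0 (cnorm_eq0 _ n0) rmorph0 scale0r subr0 unitr0.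
set t := cnorm h in u1 u2 n0.
have t0 : 0 < t by rewrite lt_neqAle eq_sym n0 cnorm_ge0.
pose s := t^-1%:C%C *: h.
have ss : self_adjoint s by apply: self_adjointZ.
have s1 : cnorm s = 1 by rewrite cnormZr gtr0_norm ?invr_gt0 // mulVf.
apply/negP: (one_sub_sqr_nonunit s ss s1).
have tC : t^-1%:C%C \is a GRing.unit.
  by rewrite unitfE (inj_eq (@complexI R) _ 0) invr_eq0.
have tK : t^-1%:C%C * t%:C%C = 1 by rewrite -rmorphM mulVf // rmorph1.
have -> : 1 - s * s = (1 - s) * (1 + s).
  by rewrite mulrDr mulr1 mulrBl mul1r addrA subrK.
have -> : 1 - s = t^-1%:C%C *: (t%:C%C%:A - h) by rewrite scalerBr scalerA tK scale1r.
have -> : 1 + s = t^-1%:C%C *: (t%:C%C%:A + h) by rewrite scalerDr scalerA tK scale1r.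
by rewrite negbK unitrMl !scaler_unit.
Qed.

(** If l = r + im with m nonzero, then (h - r) - im is a unit by [unit_imagD]; if l is real with |l|
    > |h|, then h is a small perturbation of -l. *)
Lemma spectrum_self_adjoint h (l : R[i]) : self_adjoint h ->
  h - l%:A \isn't a GRing.unit -> exists2 r, l = r%:C%C & `|r| <= cnorm h.
Proof.
move=> sh nu; have li : l = (complex.Re l)%:C%C + 'i * (complex.Im l)%:C%C.
  by rewrite {1}(complexE l) complexiE.
set r := complex.Re l in li; set m := complex.Im l in li.
have [m0|m0] := eqVneq m 0; last first.
  case/negP: nu; rewrite li scalerDl opprD addrA.
  have -> : - ('i * m%:C%C)%:A = imag (- m) :> A by rewrite /imag rmorphN mulrN scaleNr.
  by apply: unit_imagD; rewrite ?oppr_eq0 //; apply/self_adjointB/self_adjointA.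
have lr : l = r%:C%C by rewrite li m0 rmorph0 mulr0 addr0.
exists r => //; rewrite leNgt; apply/negP => hr; case/negP: nu.
have r0 : r != 0 by apply: contraTneq hr => ->; rewrite normr0 -leNgt cnorm_ge0.
have rC : r%:C%C != 0 by rewrite (inj_eq (@complexI R) _ 0).
have [||+ _] := unit_perturb (fun=> True) (- l%:A) h full_subalgebra _ I I.
- by rewrite lr unitrN unit_alg.
- rewrite lr invrN cnormN invrZ ?unitfE ?unitr1 // invr1 -fmorphV cnormA.
  by rewrite normfV mulrC ltr_pdivrMr ?mul1r // normr_gt0.
by rewrite addrC.
Qed.

(** Take t = |c| + 1 and k = t - c, and suppose |k| >= t. Then |k| in the spectrum of k would put t
    - |k| <= 0 in that of c, which positivity and invertibility forbid, and -|k| would put t + |k| >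
    |c| there. *)
Lemma positive_unit_near c : positive c -> c \is a GRing.unit ->
  exists2 t, 0 < t & cnorm (t%:C%C%:A - c) < t.
Proof.
move=> [sc pc] uc; have c0 := cnorm_ge0 c.
pose t := cnorm c + 1; have t0 : 0 < t by rewrite /t; lra.
exists t => //; rewrite ltNge; apply/negP; set k := _ - c => tk.
have sk : self_adjoint k by apply: self_adjointB => //; apply: self_adjointA.
apply: (cnorm_spectrum k sk); split.
  apply/negPn/negP => nu.
  have nu' : c - (t - cnorm k)%:C%C%:A \isn't a GRing.unit.
    apply: contra nu; rewrite /k rmorphB scalerBl !opprB.
    by rewrite addrCA addrC.
  have := pc _ nu'; rewrite /= ler0c => h0.
  have tk0 : t - cnorm k = 0 by lra.
  by move: nu'; rewrite tk0 rmorph0 scale0r subr0 uc.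
apply/negPn/negP => nu.
have nu' : c - (t + cnorm k)%:C%C%:A \isn't a GRing.unit.
  apply: contra nu; rewrite -unitrN opprB rmorphD scalerDl /k.
  by rewrite addrA (addrC _ t%:C%C%:A).
have [r rE hr] := spectrum_self_adjoint c _ sc nu'.
move: hr; rewrite -(complexI rE) ger0_norm; last lra.
by rewrite /t; lra.
Qed.

(* [q = 1 - f], where [f] is the fixed point of the contraction [f |-> (e + f^2) / 2]. *)
Lemma sqrt_one_sub e : self_adjoint e -> cnorm e < 1 ->
  exists q, [/\ self_adjoint q, q \is a GRing.unit & q * q = 1 - e].
Proof.
move=> se e1; have e0 := cnorm_ge0 e; set r := cnorm e in e0 e1.
pose F f := (1 / 2)%:C%C *: (e + f * f).
pose f n := iter n F 0.
have FB a b : cnorm (F a - F b) <= 1 / 2 * (cnorm a + cnorm b) * cnorm (a - b).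
  rewrite /F -scalerBr opprD addrACA subrr add0r cnormZr ger0_norm; last lra.
  rewrite -mulrA; apply: ler_wpM2l; first lra.
  have -> : a * a - b * b = a * (a - b) + (a - b) * b.
    by rewrite mulrBr mulrBl addrA subrK.
  rewrite (le_trans (cnormD _ _)) // [leRHS]mulrDl lerD ?(le_trans (cnormM _ _)) //.
  by rewrite mulrC.
have fr n : cnorm (f n) <= r.
  elim: n => [|n IH]; first by rewrite cnorm0.
  rewrite /= /F cnormZr ger0_norm; last lra.
  have := cnormD e (f n * f n); have := cnormM (f n) (f n); have := cnorm_ge0 (f n).
  rewrite -/r; nra.
have [n|l hl] := cauchy_geometric f 1 r e0 e1.
  elim: n => [|n IH].
    rewrite subr0 expr0 (le_trans (fr _)) // mulr1; lra.
  rewrite (le_trans (FB _ _)) // exprS.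
  have := fr n.+1; have := fr n; have := cnorm_ge0 (f n.+1 - f n); rewrite mul1r in IH *.
  nra.
(* An element dominated by the errors of two successive iterates vanishes; this gives both
   [star l = l] and [F l = l]. *)
have tend (a : A) (K : R) :
    (forall n, cnorm a <= K * cnorm (f n - l) + cnorm (f n.+1 - l)) -> a = 0.
  move=> ha; apply: cnorm_lt_eq0 => d d0.
  have K0 : 0 < `|K| + 1 by rewrite ltr_wpDl.
  have [|N hN] := hl (d / 2 / (`|K| + 1)); first by rewrite divr_gt0 //; lra.
  have [|N' hN'] := hl (d / 2); first lra.
  have /hN := leq_maxl N N'; have /leqW/hN' := leq_maxr N N'.
  have := ha (maxn N N'); have := cnorm_ge0 (f (maxn N N') - l).
  rewrite (ltr_pdivlMr _ _ K0) => x0 h1 h2 h3.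
  have := ler_wpM2r x0 (ler_norm K); lra.
have lr : cnorm l <= r.
  rewrite -subr_le0 leNgt; apply/negP => /hl[N /(_ N (leqnn _))].
  rewrite -cnormN opprB => hN.
  have := cnormD (l - f N) (f N); rewrite subrK; have := fr N; lra.
have sl : self_adjoint l.
  have sf n : self_adjoint (f n).
    elim: n => [|n IH]; first exact: star0.
    by apply/self_adjointZ/self_adjointD => //; apply: self_adjoint_sqr.
  apply/eqP; rewrite -subr_eq0; apply/eqP; apply: (tend _ 2) => n.
  have -> : star l - l = (f n - l) - star (f n - l).
    by rewrite starB sf opprB [RHS]addrC addrA subrK.
  have := cnormB (f n - l) (star (f n - l)); rewrite cnorm_star.
  have := cnorm_ge0 (f n.+1 - l); lra.
have lF : F l - l = 0.
  apply: (tend _ 1) => n; rewrite -(subrK (f n.+1) (F l)) -addrA.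
  rewrite (le_trans (cnormD _ _)) // lerD2r (le_trans (FB _ _)) //.
  rewrite -[cnorm (l - _)]cnormN opprB.
  have := fr n; have := cnorm_ge0 (f n - l); nra.
exists (1 - l); split.
- by apply: self_adjointB => //; apply: star1.
- by have [] := neumann _ l full_subalgebra I (le_lt_trans lr e1).
have l2 : e + l * l = l + l.
  have lE : F l = l by apply/eqP; rewrite -subr_eq0 lF.
  transitivity (F l + F l); last by rewrite lE.
  rewrite /F -scalerDl -rmorphD.
  by have -> : 1 / 2 + 1 / 2 = 1 :> R; [lra | rewrite rmorph1 scale1r].
rewrite mulrBr mulr1 mulrBl mul1r.
have -> : l - l * l = e - l; last by rewrite opprB addrA subrK.
by apply/eqP; rewrite subr_eq addrAC -subr_eq opprK l2.
Qed.

(** The rescaling c = t (1 - e) with |e| < 1 reduces this to [sqrt_one_sub]. *)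
Lemma positive_unit_sqrt c : positive c -> c \is a GRing.unit ->
  exists q, [/\ self_adjoint q, q \is a GRing.unit & q * q = c].
Proof.
move=> pc uc; have [t t0 tc] := positive_unit_near c pc uc; have [sc _] := pc.
pose e := t^-1%:C%C *: (t%:C%C%:A - c).
have [||q [sq uq qe]] := sqrt_one_sub e.
- by apply/self_adjointZ/self_adjointB => //; apply: self_adjointA.
- by rewrite cnormZr gtr0_norm ?invr_gt0 // mulrC ltr_pdivrMr // mul1r.
have s0 : Num.sqrt t != 0 by rewrite sqrtr_eq0 -ltNge.
exists ((Num.sqrt t)%:C%C *: q); split.
- exact: self_adjointZ.
- by rewrite scaler_unit // unitfE (inj_eq (@complexI R) _ 0).
rewrite -scalerAl -scalerAr scalerA -rmorphM -expr2 sqr_sqrtr ?ltW // qe /e.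
rewrite scalerBr scalerA -rmorphM mulfV ?gt_eqF // rmorph1 scale1r.
by rewrite opprB addrC subrK.
Qed.

End Spectrum.

(** * The upper half-plane and completely positive maps *)

Section HalfPlane.
Context {R : realType} {A : cstarAlgType R}.
Implicit Types (a b c h k q : A) (t : R).

Definition re_part a : A := (2^-1)%:C%C *: (a + star a).
Definition im_part a : A := - 'i *: ((2^-1)%:C%C *: (a - star a)).

Lemma re_im_part a : a = re_part a + 'i *: im_part a.
Proof.
rewrite /re_part /im_part scalerA mulrN -expr2 sqrCi opprK scale1r -scalerDr.
rewrite addrACA subrr addr0 -mulr2n -scaler_nat scalerA -(rmorph_nat (real_complex R)).
by rewrite -rmorphM mulVf ?pnatr_eq0 // rmorph1 scale1r.
Qed.

Lemma self_adjoint_re_part a : self_adjoint (re_part a).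
Proof. by apply: self_adjointZ; rewrite /self_adjoint starD starK addrC. Qed.

Lemma self_adjoint_im_part a : self_adjoint (im_part a).
Proof.
rewrite /self_adjoint /im_part !scaleNr starN starZi starZr starB starK.
by rewrite opprK -scalerN -scalerN opprB.
Qed.

Lemma cnorm_half_le a b : cnorm b <= cnorm a -> cnorm ((2^-1)%:C%C *: (a + b)) <= cnorm a.
Proof.
move=> ba; rewrite cnormZr gtr0_norm ?invr_gt0 //.
have := cnormD a b; lra.
Qed.

Lemma cnorm_re_part a : cnorm (re_part a) <= cnorm a.
Proof. by rewrite cnorm_half_le // cnorm_star. Qed.

Lemma cnorm_im_part a : cnorm (im_part a) <= cnorm a.
Proof. by rewrite /im_part scaleNr cnormN cnormZi cnorm_half_le // cnormN cnorm_star. Qed.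

(** The element is q (q^-1 k q^-1 + it) q, with q^-1 k q^-1 self-adjoint. *)
Lemma unit_sqr_imag k q t : self_adjoint k -> self_adjoint q ->
  q \is a GRing.unit -> t != 0 -> k + imag t * (q * q) \is a GRing.unit.
Proof.
move=> sk sq uq t0.
have -> : k + imag t * (q * q) = q * (q^-1 * k * q^-1 + imag t) * q.
  by rewrite mulrDr mulrDl !mulrA divrr // mul1r divrK // (comm_imag t q) -!mulrA.
rewrite unitrMl // unitrMr // unit_imagD //.
by rewrite /self_adjoint !starM starV sk sq mulrA.
Qed.

Lemma upper_half_plane_factor b : upper_half_plane b -> exists q h,
  [/\ self_adjoint q, q \is a GRing.unit, self_adjoint h & b = q * (h + imag 1) * q].
Proof.
move=> [pb ub]; have [q [sq uq qc]] := positive_unit_sqrt _ pb ub.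
exists q, (q^-1 * re_part b * q^-1); split=> //.
  by rewrite /self_adjoint !starM starV sq self_adjoint_re_part mulrA.
rewrite mulrDr mulrDl !mulrA divrr // mul1r divrK // (comm_imag 1 q) -mulrA qc.
rewrite {1}(re_im_part b) /im_part /imag mulr_algl !scalerA rmorph1 mulr1 invfM.
rewrite invCi fmorphV rmorph_nat; congr (_ + _ *: _); ring.
Qed.

Lemma unit_add_sqr h t r : self_adjoint h -> 0 <= t -> 0 < r ->
  r%:C%C%:A + t%:C%C *: (h * h) \is a GRing.unit.
Proof.
move=> sh t0 r0; pose s := (Num.sqrt (t / r))%:C%C *: h.
have -> : r%:C%C%:A + t%:C%C *: (h * h) = r%:C%C *: (1 + s * s).
  rewrite /s -scalerAl -scalerAr scalerA -rmorphM -(expr2 (Num.sqrt _)) sqr_sqrtr; last first.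
    by rewrite divr_ge0 // ltW.
  by rewrite scalerDr scalerA -rmorphM mulrC divfK // gt_eqF.
rewrite scaler_unit; first exact/unit_add1_sqr/self_adjointZ.
by rewrite unitfE (inj_eq (@complexI R) _ 0) gt_eqF.
Qed.

(** Write D = 1 + h^2 and k = 1 - D^-1. For t >= 1 both t - k = D^-1 (t + (t - 1) h^2) and t + k =
    D^-1 (t + (t + 1) h^2) are units, which excludes |k| >= 1. The strict bound passes to E(k) and
    makes E(D^-1) = 1 - E(k) the square of a unit. *)
Lemma cnorm_one_sub_inv_add1_sqr h : self_adjoint h -> cnorm (1 - (1 + h * h)^-1) < 1.
Proof.
move=> sh; have uD := unit_add1_sqr h sh; set D := 1 + h * h in uD *.
set k := 1 - _; rewrite ltNge; apply/negP => k1.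
have sk : self_adjoint k.
  apply/self_adjointB/self_adjointV; first exact: star1.
  by apply/self_adjointD/self_adjoint_sqr => //; apply: star1.
apply: (cnorm_spectrum k sk); move: (cnorm k) k1 => t t1; split.
  have -> : t%:C%C%:A - k = D^-1 * (t%:C%C%:A + (t - 1)%:C%C *: (h * h)).
    apply: (mulrI uD); rewrite mulVKr // /k opprB mulrDr mulrBr divrr // mulr1 mulr_algr.
    have -> : 1 - D = - (h * h) by rewrite /D opprD addrA subrr sub0r.
    by rewrite /D scalerDr rmorphB rmorph1 scalerBl scale1r addrA.
  by rewrite unitrMr ?unitrV // unit_add_sqr //; lra.
have -> : t%:C%C%:A + k = D^-1 * (t%:C%C%:A + (t + 1)%:C%C *: (h * h)).
  apply: (mulrI uD); rewrite mulVKr // /k mulrDr mulrBr mulr1 divrr //.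
  have -> : D - 1 = h * h by rewrite /D addrC addKr.
  by rewrite mulr_algr /D scalerDr rmorphD rmorph1 scalerDl scale1r addrA.
by rewrite unitrMr ?unitrV // unit_add_sqr //; lra.
Qed.

End HalfPlane.

(** * Norm bounds for completely positive and completely bounded maps *)

Section Expectations.
Context {R : realType} {A B : cstarAlgType R}.
Implicit Types (a : A) (b : B).

Lemma mxpositive_scalar {D : cstarAlgType R} (d : D) :
  mxpositive (d%:M : 'M_1) <-> positive d.
Proof.
have inv1 (a : D) : mxinvertible (a%:M : 'M_1) <-> a \is a GRing.unit.
  split=> [[N [/matrixP/(_ 0 0) N1 /matrixP/(_ 0 0) N2]]|ua].
    rewrite mxE big_ord1 !mxE /= mulr1n in N1; rewrite mxE big_ord1 !mxE /= mulr1n in N2.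
    by apply/unitrP; exists (N ord0 ord0).
  by exists a^-1%:M; rewrite -!scalar_mxM divrr // mulVr.
have sp l : mxspectrum (d%:M : 'M_1) l <-> spectrum d l.
  rewrite /mxspectrum /spectrum /= -raddfB inv1; split=> [/negP|/negP] //.
have st : mxstar (d%:M : 'M_1) = d%:M <-> self_adjoint d.
  split=> [/matrixP/(_ 0 0)|sd]; first by rewrite !mxE /= !mulr1n.
  by apply/matrixP => i j; rewrite !mxE !ord1 /= !mulr1n.
by split=> -[s p]; split; [exact/st|move=> l /sp/p|exact/st|move=> l /sp/p].
Qed.

Lemma map_scalar_mx1 (f : A -> B) a : map_mx f (a%:M : 'M_1) = (f a)%:M.
Proof. by apply/matrixP => i j; rewrite !mxE !ord1 /= !mulr1n. Qed.

Lemma completely_positive_positive (f : {linear A -> B}) a :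
  completely_positive f -> positive a -> positive (f a).
Proof. by move=> fp /mxpositive_scalar/fp; rewrite map_scalar_mx1 => /mxpositive_scalar. Qed.

Lemma positive_cnorm_add (h : A) : self_adjoint h -> positive ((cnorm h)%:C%C%:A + h).
Proof.
move=> sh; split; first by apply: self_adjointD => //; apply: self_adjointA.
move=> l /= nu.
have nu' : h - (l - (cnorm h)%:C%C)%:A \isn't a GRing.unit.
  by apply: contra nu; rewrite scalerBl opprB addrA (addrC h).
have [r lr hr] := spectrum_self_adjoint h _ sh nu'.
have -> : l = (r + cnorm h)%:C%C by rewrite rmorphD /= -lr subrK.
by move: hr; rewrite ler0c ler_norml => /andP[hr _]; lra.
Qed.

(** The map f keeps |h| + h and |h| - h positive. If |f h| > |h|, then |f h| or -|f h| lies in the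
    spectrum of f h, which puts the negative number |h| - |f h| in the spectrum of |h| - f h or of
    |h| + f h. *)
Lemma cnorm_self_adjoint_le (f : {linear A -> B}) (h : A) :
    completely_positive f -> f 1 = 1 -> self_adjoint h ->
  self_adjoint (f h) /\ cnorm (f h) <= cnorm h.
Proof.
move=> fp f1 sh; pose n := cnorm h.
have fA t : f (t%:C%C%:A) = t%:C%C%:A by rewrite linearZ /= f1.
have := positive_cnorm_add h sh => /(completely_positive_positive f _ fp).
rewrite linearD fA => -[sp pp].
have sfh : self_adjoint (f h).
  have -> : f h = (n%:C%C%:A + f h) - n%:C%C%:A by rewrite addrC addKr.
  by apply: self_adjointB => //; apply: self_adjointA.
split=> //; rewrite leNgt; apply/negP => lt.
have /(completely_positive_positive f _ fp) : positive (n%:C%C%:A - h).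
  by have := positive_cnorm_add (- h); rewrite cnormN; apply; rewrite /self_adjoint starN sh.
rewrite linearB fA => -[_ pm].
have n0 : 0 < cnorm (f h) - n by rewrite subr_gt0.
apply: (cnorm_spectrum (f h) sfh); split; apply/negPn/negP => nu.
  have /pm : ~~ (n%:C%C%:A - f h - (n - cnorm (f h))%:C%C%:A \is a GRing.unit).
    apply: contra nu; rewrite rmorphB scalerBl opprB.
    by rewrite (addrC (n%:C%C%:A - _)) addrA subrK.
  by rewrite /= ler0c; lra.
have /pp : ~~ (n%:C%C%:A + f h - (n - cnorm (f h))%:C%C%:A \is a GRing.unit).
  apply: contra nu; rewrite rmorphB scalerBl opprB.
  by rewrite (addrC (n%:C%C%:A + _)) addrA subrK.
by rewrite /= ler0c; lra.
Qed.

(** The factor 2 counts the real and imaginary parts of [a]; the bound serves only for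
    continuity. *)
Lemma completely_positive_bounded (f : {linear A -> B}) a :
  completely_positive f -> f 1 = 1 -> cnorm (f a) <= 2 * cnorm a.
Proof.
move=> fp f1; rewrite {1}(re_im_part a) linearD [f (_ *: im_part a)]linearZ /=.
rewrite (le_trans (cnormD _ _)) // cnormZi.
have [_] := cnorm_self_adjoint_le f _ fp f1 (self_adjoint_re_part a).
have [_] := cnorm_self_adjoint_le f _ fp f1 (self_adjoint_im_part a).
have := cnorm_re_part a; have := cnorm_im_part a; lra.
Qed.

(** The supremum is attained at the column 1. The order-one case turns complete boundedness into an
    ordinary bound. *)
Lemma mxnorm_scalar {D : cstarAlgType R} (d : D) : mxnorm (d%:M : 'M_1) = cnorm d.
Proof.
have cn (v : 'cV[D]_1) : colnorm v = cnorm (v 0 0).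
  by rewrite /colnorm big_ord1 cstar_identity sqrtr_sqr ger0_norm ?cnorm_ge0.
have ub : ubound (T := R)
    [set colnorm (d%:M *m v) | v in [set v : 'cV[D]_1 | colnorm v <= 1]]%classic (cnorm d).
  move=> _ [v /= v1 <-]; rewrite cn mul_scalar_mx mxE (le_trans (cnormM _ _)) //.
  by rewrite ler_piMr ?cnorm_ge0 // -cn.
have mem : [set colnorm (d%:M *m v) | v in [set v : 'cV[D]_1 | colnorm v <= 1]]%classic (cnorm d).
  exists (const_mx 1) => /=; first by rewrite cn mxE cnorm1.
  by rewrite cn mul_scalar_mx !mxE mulr1.
apply/eqP; rewrite eq_le; apply/andP; split; first by apply: ge_sup => //; exists (cnorm d).
by apply: ub_le_sup => //; exists (cnorm d).
Qed.

Lemma completely_bounded_bounded (f : {linear A -> B}) :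
  completely_bounded f -> exists K : R, forall a, cnorm (f a) <= K * cnorm a.
Proof.
move=> [K fK]; exists K => a.
by have := fK 1%N a%:M; rewrite map_scalar_mx1 !mxnorm_scalar.
Qed.

(** * Resolvents at points of the half-plane and invertibility of Cauchy transforms *)

Section Inclusion.
Context (inc : {lrmorphism B -> A}) (hinc : cstar_inclusion inc).

Lemma inc_self_adjoint b : self_adjoint b -> self_adjoint (inc b).
Proof. by rewrite /self_adjoint -(inc_star hinc) => ->. Qed.

Lemma inc_imag t : inc (imag t) = imag t.
Proof. exact: rmorph_alg. Qed.

(** If b = q (k + i) q, then h = k - q^-1 x q^-1. The last clause records that h is built from B and
    x alone. *)
Lemma resolvent_factor x b : self_adjoint x -> upper_half_plane b -> exists q h,
  [/\ self_adjoint q, q \is a GRing.unit, self_adjoint h,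
      inc b - x = inc q * (h + imag 1) * inc q &
      forall T, subalgebra T -> (forall c, T (inc c)) -> T x -> T h].
Proof.
move=> sx /upper_half_plane_factor[q [h [sq uq sh bE]]].
have uiq : inc q \is a GRing.unit by rewrite rmorph_unit.
exists q, (inc h - inc q^-1 * x * inc q^-1); split=> //.
- apply: self_adjointB; first exact: inc_self_adjoint.
  by rewrite /self_adjoint !starM -(inc_star hinc) sx starV sq mulrA.
- rewrite bE !rmorphM rmorphD /= inc_imag rmorphV // addrAC mulrBr mulrBl; congr (_ - _).
  by rewrite !mulrA divrr // mul1r divrK.
- move=> T [T1 TD TZ TM] Ti Tx; apply: TD => //; rewrite -scaleN1r.
  by apply: TZ; apply: (TM) => //; apply: TM.
Qed.

Lemma unit_resolvent x b : self_adjoint x -> upper_half_plane b ->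
  inc b - x \is a GRing.unit.
Proof.
move=> sx hb; have [q [h [sq uq sh -> _]]] := resolvent_factor x b sx hb.
rewrite unitrMl ?rmorph_unit // unitrMr ?rmorph_unit // unit_imagD //.
exact: oner_neq0.
Qed.

(** The inverse is q^-1 (h + i)^-1 q^-1 with h in [T], and [resolvent_mem] places the middle factor
    in [T]. *)
Lemma resolvent_closed_subalgebra T x b : closed_subalgebra T ->
    (forall c, T (inc c)) -> self_adjoint x -> T x -> upper_half_plane b ->
  T (inc b - x)^-1.
Proof.
move=> hT Ti sx Tx hb; have [q [h [sq uq sh -> Th]]] := resolvent_factor x b sx hb.
have uiq : inc q \is a GRing.unit by rewrite rmorph_unit.
have [sT _] := hT.
have [|ui Tv] := resolvent_mem T h 1 hT sh (Th T sT Ti Tx); first exact: ltr01.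
have [_ _ _ TM] := sT.
rewrite invrM ?invrM -?rmorphV ?unitrMr //.
by apply: (TM); [exact: Ti | apply: TM => //; exact: Ti].
Qed.

(** The bimodule property reduces the claim to E((h + i)^-1) = E(D^-1 h) - i E(D^-1), where D = 1 +
    h^2. Here E(D^-1) = p^2 with p a self-adjoint unit, and [unit_sqr_imag] applies with t = -1. *)
Lemma unit_cauchy_transform (E : {linear A -> B}) x b :
    completely_positive E -> E 1 = 1 ->
    (forall a b b', E (inc b * a * inc b') = b * E a * b') ->
    self_adjoint x -> upper_half_plane b ->
  cauchy_transform inc E x b \is a GRing.unit.
Proof.
move=> cp E1 bim sx hb; rewrite /cauchy_transform.
have [q [h [sq uq sh -> _]]] := resolvent_factor x b sx hb.
have uiq : inc q \is a GRing.unit by rewrite rmorph_unit.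
have ui := unit_imagD h 1 sh (oner_neq0 _).
rewrite invrM ?invrM -?rmorphV ?unitrMr // mulrA bim.
rewrite unitrMl ?unitrV // unitrMr ?unitrV //.
have uD := unit_add1_sqr h sh; set D := 1 + h * h in uD.
have -> : (h + imag 1)^-1 = D^-1 * h - 'i *: D^-1.
  have -> : 'i *: D^-1 = D^-1 * imag 1 by rewrite /imag rmorph1 mulr1 mulr_algr.
  rewrite -mulrBr; apply: (mulrI uD); rewrite mulVKr //.
  by rewrite {1}/D add1_sqr_factor mulrK.
rewrite linearB linearZ /=.
have sD : self_adjoint D by apply: self_adjointD; [exact: star1|exact: self_adjoint_sqr].
have sDh : self_adjoint (D^-1 * h).
  by rewrite /self_adjoint starM starV sD sh (comm_inv_add1_sqr h).
have [sk _] := cnorm_self_adjoint_le E _ cp E1 sDh.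
have sn : self_adjoint (1 - D^-1) by apply/self_adjointB/self_adjointV => //; exact: star1.
have [sN hN] := cnorm_self_adjoint_le E _ cp E1 sn.
have [p [sp up pE]] := sqrt_one_sub _ sN (le_lt_trans hN (cnorm_one_sub_inv_add1_sqr h sh)).
have -> : E D^-1 = p * p by rewrite pE linearB E1 subKr.
have -> : - ('i *: (p * p)) = imag (-1) * (p * p).
  by rewrite /imag mulr_algl rmorphN rmorph1 mulrN mulr1 scaleNr.
by apply: unit_sqr_imag => //; rewrite oppr_eq0 oner_eq0.
Qed.

End Inclusion.
End Expectations.

(** * Alternating words *)

Section Words.
Context {R : realType} {A : cstarAlgType R} (S : bool -> A -> Prop).
Implicit Types (a v w : A) (l : bool).

(** The index is the label of the first letter, which decides what may be put in front of the
    word. *)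
Inductive word : bool -> A -> Prop :=
| word1 l a : S l a -> word l a
| wordS l a v : S l a -> word (~~ l) v -> word l (a * v).

Inductive word_span l : A -> Prop :=
| word_span1 v : word l v -> word_span l v
| word_spanD v w : word_span l v -> word_span l w -> word_span l (v + w)
| word_spanZ k v : word_span l v -> word_span l (k *: v).

Lemma word_prod l v : word l v -> exists n (i : 'I_n.+1 -> bool) (f : 'I_n.+1 -> A),
  [/\ forall j, S (i j) (f j), forall j k : 'I_n.+1, k = j.+1 :> nat -> i j <> i k,
      i ord0 = l & v = \prod_(j < n.+1) f j].
Proof.
elim=> {l v} [l a Sa|l a v Sa _ [n [i [f [Sf alt i0 ->]]]]].
  exists 0%N, (fun=> l), (fun=> a); split=> //; last by rewrite big_ord1.
  by move=> j k; rewrite !ord1.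
(* Through [unlift ord0] the new letter comes first: index 0 carries [a], and index j + 1 the former
   index j. *)
exists n.+1, (fun j => if unlift ord0 j is Some j' then i j' else l),
  (fun j => if unlift ord0 j is Some j' then f j' else a); split.
- by move=> j; case: unliftP.
- move=> j k; case: (unliftP ord0 k) => [k' ->|->] //; rewrite lift0 => -[].
  case: (unliftP ord0 j) => [j' ->|->]; first by rewrite lift0; apply: alt.
  move=> k0; have -> : k' = ord0 by apply: val_inj.
  by rewrite i0; case: l {Sa i0}.
- by rewrite unlift_none.
- rewrite [RHS]big_ord_recl /= unlift_none; congr (_ * _).
  by apply: eq_bigr => j _; rewrite liftK.
Qed.

Lemma word_span_cons l a v : S l a -> word_span (~~ l) v -> word_span l (a * v).
Proof.
move=> Sa; elim=> {v} [v wv|v w _ IHv _ IHw|k v _ IH].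
- by apply/word_span1/wordS.
- by rewrite mulrDr; apply: word_spanD.
- by rewrite -scalerAr; apply: word_spanZ.
Qed.

(** Word spans need not contain 1, but their right multipliers form a unital algebra, whose closure
    can contain a resolvent. Testing on single letters suffices by [word_span_extender]. *)
Definition word_extender v := forall l a, S l a -> word_span l (a * v).

Lemma word_span_extender l v w : word_span l v -> word_extender w -> word_span l (v * w).
Proof.
move=> + ew; elim=> {v} [v|v v' _ IH _ IH'|k v _ IH].
- by elim=> {l v} [l a /ew //|l a v Sa _ IH]; rewrite -mulrA; apply: word_span_cons.
- by rewrite mulrDl; apply: word_spanD.
- by rewrite -scalerAl; apply: word_spanZ.
Qed.

Lemma word_extender_subalgebra : subalgebra word_extender.
Proof.
split.
- by move=> l a Sa; rewrite mulr1; apply/word_span1/word1.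
- by move=> v w ev ew l a Sa; rewrite mulrDr; apply: word_spanD; [apply: ev|apply: ew].
- by move=> k v ev l a Sa; rewrite -scalerAr; apply/word_spanZ/ev.
- by move=> v w ev ew l a Sa; rewrite mulrA; apply: word_span_extender => //; apply: ev.
Qed.

End Words.

(** * Lipschitz maps and identities on norm closures *)

Definition lipschitz {R : realType} {A B : cstarAlgType R} (f : A -> B) :=
  exists K : R, forall a b, cnorm (f a - f b) <= K * cnorm (a - b).

Section Lipschitz.
Context {R : realType} {A B : cstarAlgType R}.
Implicit Types (f g : A -> B).

Lemma lipschitz_linear (f : {linear A -> B}) :
  (exists K : R, forall a, cnorm (f a) <= K * cnorm a) -> lipschitz f.
Proof. by move=> [K fK]; exists K => a b; rewrite -linearB. Qed.

Lemma lipschitzD f g : lipschitz f -> lipschitz g -> lipschitz (fun a => f a + g a).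
Proof.
move=> [K fK] [K' gK]; exists (K + K') => a b.
by rewrite opprD addrACA mulrDl (le_trans (cnormD _ _)) // lerD.
Qed.

Lemma lipschitzB f g : lipschitz f -> lipschitz g -> lipschitz (fun a => f a - g a).
Proof.
move=> lf [K gK]; apply: lipschitzD => //; exists K => a b.
by rewrite -opprD cnormN.
Qed.

Lemma lipschitz_mull (c : B) f : lipschitz f -> lipschitz (fun a => c * f a).
Proof.
move=> [K fK]; exists (cnorm c * K) => a b.
by rewrite -mulrBr (le_trans (cnormM _ _)) // -mulrA ler_wpM2l ?cnorm_ge0.
Qed.

Lemma lipschitz_mulr (c : B) f : lipschitz f -> lipschitz (fun a => f a * c).
Proof.
move=> [K fK]; exists (cnorm c * K) => a b.
by rewrite -mulrBl (le_trans (cnormM _ _)) // mulrC -mulrA ler_wpM2l ?cnorm_ge0.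
Qed.

Lemma lipschitz_compl (u : A) f : lipschitz f -> lipschitz (fun a => f (u * a)).
Proof.
move=> [K fK]; exists (`|K| * cnorm u) => a b.
rewrite (le_trans (fK _ _)) // -mulrBr -mulrA.
rewrite (le_trans (ler_wpM2r (cnorm_ge0 _) (ler_norm K))) //.
by rewrite ler_wpM2l // cnormM.
Qed.

Lemma lipschitz_compr (u : A) f : lipschitz f -> lipschitz (fun a => f (a * u)).
Proof.
move=> [K fK]; exists (`|K| * cnorm u) => a b.
rewrite (le_trans (fK _ _)) // -mulrBl -mulrA.
rewrite (le_trans (ler_wpM2r (cnorm_ge0 _) (ler_norm K))) //.
by rewrite ler_wpM2l // mulrC cnormM.
Qed.

Lemma lipschitz_eq0 (P : A -> Prop) f : lipschitz f -> (forall a, P a -> f a = 0) ->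
  forall a, norm_closure P a -> f a = 0.
Proof.
move=> [K fK] f0 a Pa; apply: cnorm_lt_eq0 => e.
have : norm_closure (eq 0) (f a).
  apply: (norm_closure_lipschitz f K P _ a (fK a)) Pa => b /f0 ->.
  exact: subset_norm_closure.
by move=> h /h[s [<-]]; rewrite subr0.
Qed.

End Lipschitz.

(** * Two-factor rules drawn from Boolean independence *)

Section Independence.
Context {R : realType} {A B : cstarAlgType R} (E E' : {linear A -> B}).
Context (S : bool -> A -> Prop).
Implicit Types (a u v : A) (l : bool).

Definition boolean_factor u v :=
  E (u * v) = E u * E v /\ E' (u * v) = E' u * E v + E u * E' v.

(** Independence is applied to the letters of v and to the same letters preceded by u, which still
    alternate; comparing the two formulas gives the rule. *)
Lemma word_boolean_factor l u v : inf_boolean_independent E E' S ->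
  S (~~ l) u -> word S l v -> boolean_factor u v.
Proof.
move=> ind Su /word_prod[n [i [f [Sf alt i0 ->]]]].
have [Ef E'f] := ind _ i f Sf alt.
pose i1 (j : 'I_n.+2) := if unlift ord0 j is Some j' then i j' else ~~ l.
pose f1 (j : 'I_n.+2) := if unlift ord0 j is Some j' then f j' else u.
have f10 : f1 ord0 = u by rewrite /f1 unlift_none.
have f1S j : f1 (lift ord0 j) = f j by rewrite /f1 liftK.
have [||] := ind _ i1 f1.
- by move=> j; rewrite /i1 /f1; case: unliftP.
- move=> j k; rewrite /i1; case: (unliftP ord0 k) => [k' ->|->] //; rewrite lift0 => -[].
  case: (unliftP ord0 j) => [j' ->|->]; first by rewrite lift0; apply: alt.
  move=> k0; have -> : k' = ord0 by apply: val_inj.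
  by rewrite i0; case: l {Su i0 i1}.
have P1 : \prod_(j < n.+2) f1 j = u * \prod_(j < n.+1) f j.
  by rewrite big_ord_recl f10; congr (_ * _); apply: eq_bigr => j _.
rewrite P1 [\prod_(j < n.+2) E _]big_ord_recl [\sum_(j < n.+2) _]big_ord_recl f10 => E1 E1'.
have EP : \prod_(j < n.+1) E (f1 (lift ord0 j)) = E (\prod_(j < n.+1) f j).
  by rewrite Ef; apply: eq_bigr => j _; rewrite f1S.
split; first by rewrite E1 EP.
(* The term of index 0 is [E' u * E v]; the others share the left factor [E u] and sum to
   [E u * E' v]. *)
rewrite E1'; congr (_ + _).
  rewrite big_pred0 // mul1r; congr (_ * _).
  by rewrite [LHS]big_mkcond [LHS]big_ord_recl /= mul1r -EP.
rewrite E'f mulr_sumr; apply: eq_bigr => j _; rewrite f1S !mulrA.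
congr (_ * _ * _).
  rewrite [LHS]big_mkcond [LHS]big_ord_recl /= f10; congr (_ * _).
  by rewrite [RHS]big_mkcond; apply: eq_bigr => k _; rewrite ?lift0 f1S.
rewrite [LHS]big_mkcond [LHS]big_ord_recl /= mul1r.
by rewrite [RHS]big_mkcond; apply: eq_bigr => k _; rewrite ?lift0 f1S.
Qed.

Lemma word_span_boolean_factor l u v : inf_boolean_independent E E' S ->
  S (~~ l) u -> word_span S l v -> boolean_factor u v.
Proof.
move=> ind Su; elim=> {v} [v|v w _ [h1 h1'] _ [h2 h2']|k v _ [h h']].
- exact: word_boolean_factor.
- rewrite /boolean_factor mulrDr !linearD h1 h1' h2 h2' /= !mulrDr; split=> //.
  by rewrite addrACA.
- rewrite /boolean_factor -scalerAr !linearZ /= h h' -!scalerAr; split=> //.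
  by rewrite scalerDr.
Qed.

(** The limit is taken first in u, for a fixed combination of words, and then in v: the defect of
    each identity is Lipschitz in either variable separately. *)
Lemma norm_closure_boolean_factor l u v : inf_boolean_independent E E' S ->
    lipschitz E -> lipschitz E' ->
  norm_closure (S (~~ l)) u -> norm_closure (word_span S l) v -> boolean_factor u v.
Proof.
move=> ind lE lE' Su Wv.
have step w : word_span S l w -> boolean_factor u w.
  move=> Ww; split; apply/eqP; rewrite -subr_eq0; apply/eqP.
    move: Su; apply: (lipschitz_eq0 _ (fun u => E (u * w) - E u * E w)) => [|a Sa].
      by apply: lipschitzB; [apply: lipschitz_compr|apply: lipschitz_mulr].
    by have [-> _] := word_span_boolean_factor l a w ind Sa Ww; rewrite subrr.
  move: Su; apply: (lipschitz_eq0 _ (fun u => E' (u * w) - (E' u * E w + E u * E' w))).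
    apply: lipschitzB; first exact: lipschitz_compr.
    by apply: lipschitzD; apply: lipschitz_mulr.
  by move=> a Sa; have [_ ->] := word_span_boolean_factor l a w ind Sa Ww; rewrite subrr.
split; apply/eqP; rewrite -subr_eq0; apply/eqP.
  move: Wv; apply: (lipschitz_eq0 _ (fun w => E (u * w) - E u * E w)) => [|w /step[-> _]].
    by apply: lipschitzB; [apply: lipschitz_compl|apply: lipschitz_mull].
  exact: subrr.
move: Wv; apply: (lipschitz_eq0 _ (fun w => E' (u * w) - (E' u * E w + E u * E' w))).
  apply: lipschitzB; first exact: lipschitz_compl.
  by apply: lipschitzD; apply: lipschitz_mull.
by move=> w /step[_ ->]; rewrite subrr.
Qed.

End Independence.

(** * Resolvents multiplied into the generated algebras *)

Section GeneratedAlgebra.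
Context {R : realType} {A B : cstarAlgType R} (inc : {lrmorphism B -> A}) (x : A).
Local Notation S := (generated_algebra inc x).

Lemma generated_algebraM a a' : S a -> S a' -> S (a * a').
Proof. by move=> Sa Sa' T hT1 hT2 hT3 Tx; apply: (hT2); [exact: (Sa T)|exact: (Sa' T)]. Qed.

Lemma generated_algebraD a a' : S a -> S a' -> S (a + a').
Proof.
move=> Sa Sa' T hT1 hT2 hT3 Tx; rewrite -[a]scale1r.
by have [_ lin] := hT1; apply: lin; [exact: (Sa T)|exact: (Sa' T)].
Qed.

Lemma generated_algebraZ k a : S a -> S (k *: a).
Proof.
move=> Sa T hT1 hT2 hT3 Tx; rewrite -[_ *: _]addr0.
by have [T0 lin] := hT1; apply: lin => //; exact: (Sa T).
Qed.

Lemma generated_algebra_mulr_inc a b : S a -> S (a * inc b).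
Proof. by move=> Sa T hT1 hT2 hT3 Tx; apply: (hT3 b _ _).2; exact: (Sa T). Qed.

Lemma generated_algebra_gen : S x.
Proof. by []. Qed.

Definition generated_extender (v : A) := forall a, S a -> S (a * v).

Lemma generated_extender_subalgebra : subalgebra generated_extender.
Proof.
split.
- by move=> a Sa; rewrite mulr1.
- by move=> v w ev ew a Sa; rewrite mulrDr; apply: generated_algebraD; [apply: ev|apply: ew].
- by move=> k v ev a Sa; rewrite -scalerAr; apply/generated_algebraZ/ev.
- by move=> v w ev ew a Sa; rewrite mulrA; apply/ew/ev.
Qed.

(** Right multipliers of the generated algebra form a unital algebra containing B and x, so the
    resolvent is a limit of multipliers; each of them sends x into the generated algebra. *)
Lemma mul_resolvent_generated (hinc : cstar_inclusion inc) b :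
    self_adjoint x -> upper_half_plane b ->
  norm_closure S (x * (inc b - x)^-1).
Proof.
move=> sx hb; have sub := generated_extender_subalgebra.
have : norm_closure generated_extender (inc b - x)^-1.
  apply: (resolvent_closed_subalgebra inc hinc) => //; first exact: norm_closure_subalgebra.
  - by move=> c; apply: subset_norm_closure => a; apply: generated_algebra_mulr_inc.
  - by apply: subset_norm_closure => a Sa; apply: generated_algebraM.
apply: norm_closure_mull => v; move/(_ x generated_algebra_gen); exact: subset_norm_closure.
Qed.

End GeneratedAlgebra.

Lemma mul_resolvent_word_span (R : realType) (A B : cstarAlgType R)
    (inc : {lrmorphism B -> A}) (hinc : cstar_inclusion inc) (x y : A) (b : B) (l : bool) :
  self_adjoint x -> self_adjoint y -> upper_half_plane b ->
  norm_closure (word_span (fun k : bool => generated_algebra inc (if k then x else y)) l)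
    ((if l then x else y) * (inc b - (x + y))^-1).
Proof.
move=> sx sy hb; set S := fun k : bool => _.
have sub := word_extender_subalgebra S; have [_ TD _ _] := sub.
(* A generator multiplied onto a letter merges with it when the labels agree and otherwise appends a
   second letter. *)
have gen k : word_extender S (if k then x else y).
  move=> l' a Sa; case: (eqVneq k l') => [kl|kl].
    by apply/word_span1/word1/generated_algebraM => //; rewrite kl; apply: generated_algebra_gen.
  apply/word_span1/wordS => //; apply: word1.
  have -> : ~~ l' = k by move: kl; case: (l'); case: (k).
  exact: generated_algebra_gen.
have : norm_closure (word_extender S) (inc b - (x + y))^-1.
  apply: (resolvent_closed_subalgebra inc hinc) => //; first exact: norm_closure_subalgebra.
  - move=> c; apply: subset_norm_closure => l' a Sa.
    by apply/word_span1/word1/generated_algebra_mulr_inc.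
  - exact: self_adjointD.
  - by apply/subset_norm_closure/TD; [apply: (gen true)|apply: (gen false)].
apply: norm_closure_mull => v; move/(_ l _ (generated_algebra_gen _ _)); exact: subset_norm_closure.
Qed.

(** * The equations relating the transforms *)

Section TransferEquations.
Context {B : unitRingType}.

(** P, W, V stand for E(xX), E(xT), E(yT). The relations give b G = 1 + P + P V + V = (1 + P)(1 + V)
    = b Gx (1 + V). *)
Lemma transfer_F (b Gx G P W V : B) : b \is a GRing.unit -> Gx \is a GRing.unit ->
    b * Gx = 1 + P -> b * G = 1 + (W + V) -> W = P + P * V ->
  Gx^-1 * G = 1 + V.
Proof.
move=> ub ux hx hG hW; apply: (mulrI ux); rewrite mulVKr //.
apply: (mulrI ub); rewrite mulrA hx hG hW mulrDr mulr1 mulrDl mul1r.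
by rewrite -!addrA; do 2 congr (_ + _); rewrite addrC.
Qed.

(** Primed letters are the values of E'. Here b g = P' (1 + V) + (1 + P) V' = b gx Gx^-1 G + b Gx
    V', and b Gx cancels. *)
Lemma transfer_inf (b Gx G P V gx g P' W' V' : B) :
    b \is a GRing.unit -> Gx \is a GRing.unit ->
    b * Gx = 1 + P -> Gx^-1 * G = 1 + V ->
    b * gx = P' -> b * g = W' + V' -> W' = P' + (P' * V + P * V') ->
  Gx^-1 * g = Gx^-1 * gx * Gx^-1 * G + V'.
Proof.
move=> ub ux hx hV hgx hg hW; apply: (mulrI ux).
rewrite mulVKr // mulrDr -!mulrA mulVKr // hV; apply: (mulrI ub).
rewrite hg hW mulrDr !mulrA hgx hx mulrDr mulr1 [(1 + P) * _]mulrDl mul1r -!addrA.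
by do 2 congr (_ + _); rewrite addrC.
Qed.

(** Adding the two [transfer_F] equations and subtracting b G leaves (Fx + Fy - b) G = 1. In the
    same combination of the equations for g the sum W' + V' cancels, leaving (Fx gx Fx + Fy gy Fy)
    G. *)
Lemma boolean_transfer (b Gx Gy G P Q W V gx gy g P' Q' W' V' : B) :
    b \is a GRing.unit -> Gx \is a GRing.unit -> Gy \is a GRing.unit ->
    G \is a GRing.unit ->
    b * Gx = 1 + P -> b * Gy = 1 + Q -> b * G = 1 + (W + V) ->
    W = P + P * V -> V = Q + Q * W ->
    b * gx = P' -> b * gy = Q' -> b * g = W' + V' ->
    W' = P' + (P' * V + P * V') -> V' = Q' + (Q' * W + Q * W') ->
  g = (Gx^-1 + Gy^-1 - b)^-1 * (Gx^-1 * gx * Gx^-1 + Gy^-1 * gy * Gy^-1)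
      * (Gx^-1 + Gy^-1 - b)^-1.
Proof.
move=> ub ux uy uG hx hy hG hW hV hgx hgy hg hW' hV'.
have hG' : b * G = 1 + (V + W) by rewrite (addrC V).
have hg' : b * g = V' + W' by rewrite (addrC V').
have Fx := transfer_F _ _ _ _ _ _ ub ux hx hG hW.
have Fy := transfer_F _ _ _ _ _ _ ub uy hy hG' hV.
have fx := transfer_inf _ _ _ _ _ _ _ _ _ _ ub ux hx Fx hgx hg hW'.
have fy := transfer_inf _ _ _ _ _ _ _ _ _ _ ub uy hy Fy hgy hg' hV'.
have HG : (Gx^-1 + Gy^-1 - b) * G = 1.
  by rewrite mulrBl mulrDl Fx Fy hG addrACA (addrC V) -addrA addrK.
have -> : Gx^-1 + Gy^-1 - b = G^-1 by apply: (mulIr uG); rewrite HG mulVr.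
rewrite invrK; apply: (mulrI (x := G^-1)); rewrite ?unitrV // mulrA mulKr //.
rewrite -[LHS](_ : (Gx^-1 + Gy^-1 - b) * g = _); last first.
  by congr (_ * _); apply: (mulIr uG); rewrite HG mulVr.
by rewrite mulrBl mulrDl fx fy hg mulrDl addrACA (addrC W') addrK.
Qed.

End TransferEquations.

Theorem theorem1p1 (R : realType) (A B : cstarAlgType R)
    (inc : {lrmorphism B -> A}) (E E' : {linear A -> B})
    (space : cstar_inf_prob_space inc E E')
    (x y : A) (hx : self_adjoint x) (hy : self_adjoint y)
    (hxy : elements_inf_boolean_independent inc E E' x y)
    (b : B) (hb : upper_half_plane b) :
  let F := F_transform inc E in
  let g := cauchy_transform inc E' in
  g (x + y) b =
    (F x b + F y b - b)^-1
    * (F x b * g x b * F x b + F y b * g y b * F y b)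
    * (F x b + F y b - b)^-1.
Proof.
case: space => hinc cpE Einc bimE cbE' _ E'1 bimE' F g.
have E1 : E 1 = 1 by rewrite -(rmorph1 inc) Einc.
have hxy' : self_adjoint (x + y) by apply: self_adjointD.
have uG z : self_adjoint z -> cauchy_transform inc E z b \is a GRing.unit.
  by move=> sz; apply: (unit_cauchy_transform inc).
have ub : b \is a GRing.unit.
  have [q [h [sq uq sh ->]]] := upper_half_plane_factor b hb.
  by rewrite unitrMl // unitrMr // unit_imagD // oner_neq0.
have lE : lipschitz E.
  by apply: lipschitz_linear; exists 2 => a; apply: completely_positive_bounded.
have lE' : lipschitz E' by apply/lipschitz_linear/completely_bounded_bounded.
have Eb a : E (inc b * a) = b * E a.
  by rewrite -[RHS]mulr1 -bimE rmorph1 mulr1.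
have E'b a : E' (inc b * a) = b * E' a.
  by rewrite -[RHS]mulr1 -bimE' rmorph1 mulr1.
have res z : self_adjoint z -> inc b * (inc b - z)^-1 = 1 + z * (inc b - z)^-1.
  move=> sz; have uz := unit_resolvent inc hinc z b sz hb.
  by rewrite -{1}(divrr uz) -mulrDl subrK.
have split_res z z' : self_adjoint z -> self_adjoint z' ->
    z * (inc b - (z + z'))^-1 =
    z * (inc b - z)^-1 + z * (inc b - z)^-1 * (z' * (inc b - (z + z'))^-1).
  move=> sz sz'; have uz := unit_resolvent inc hinc z b sz hb.
  have uzz := unit_resolvent inc hinc (z + z') b (self_adjointD _ _ sz sz') hb.
  rewrite -{1}[z / (inc b - z)]mulr1 -mulrDr.
  have -> : 1 + z' / (inc b - (z + z')) = (inc b - z) * (inc b - (z + z'))^-1.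
    by rewrite -{1}(divrr uzz) -mulrDl opprD addrA subrK.
  by rewrite mulrA divrK.
have xR := split_res x y hx hy.
have := split_res y x hy hx; rewrite (addrC y x) => yR.
(* The label [false] is that of y, with which the words approximating the second factor begin; the
   first factor then has label [true], that of x. *)
have [Wx W'x] : boolean_factor E E' (x * (inc b - x)^-1) (y * (inc b - (x + y))^-1).
  apply: (norm_closure_boolean_factor E E' _ false _ _ hxy lE lE').
    exact: mul_resolvent_generated.
  exact: (mul_resolvent_word_span _ _ _ _ hinc x y b false).
have [Wy W'y] : boolean_factor E E' (y * (inc b - y)^-1) (x * (inc b - (x + y))^-1).
  apply: (norm_closure_boolean_factor E E' _ true _ _ hxy lE lE').
    exact: mul_resolvent_generated.
  exact: (mul_resolvent_word_span _ _ _ _ hinc x y b true).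
(* P and Q are the values at x X and y Y, W and V those at x T and y T. Since E' kills 1, the
   constant 1 appears only in the equations for E. *)
apply: (boolean_transfer b (cauchy_transform inc E x b) (cauchy_transform inc E y b)
  (cauchy_transform inc E (x + y) b)
  (E (x * (inc b - x)^-1)) (E (y * (inc b - y)^-1))
  (E (x * (inc b - (x + y))^-1)) (E (y * (inc b - (x + y))^-1)) _ _ _
  (E' (x * (inc b - x)^-1)) (E' (y * (inc b - y)^-1))
  (E' (x * (inc b - (x + y))^-1)) (E' (y * (inc b - (x + y))^-1)));
  rewrite ?uG // /g /cauchy_transform -?Eb -?E'b ?res //
    ?(linearD E) ?(linearD E') ?E1 ?E'1 ?add0r //.
- by rewrite mulrDl linearD.
- by rewrite {1}xR (linearD E) Wx.
- by rewrite {1}yR (linearD E) Wy.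
- by rewrite mulrDl linearD.
- by rewrite {1}xR (linearD E') W'x.
- by rewrite {1}yR (linearD E') W'y.
Qed.
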